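(* Let $n\ge 1$, and let $L^{-1}$ denote the weight matrix of the $L$-type network of order $n$ in which a fall edge from $(k,y)$ to $(k+1,y-1)$ (with $y\ne 0$) has weight $-t_{y,n-k-1}$ and every horizontal edge has weight $1$. Then for all $0\le i,j\le n$, $$L^{-1}[i,j]=(-1)^{i-j}\sum_{\alpha\in Q^{SD}_{i,j}}\ \prod_{s=j}^{i-1}t_{s+1,\alpha_{i-s}}.$$
   Context: Let $t_{a,b}$ be real scalars for integers $a>b\ge 0$. Rows and columns of $(n+1)\times(n+1)$ matrices are indexed by $0,\dots,n$. Paths of the $L$-type network of order $n$ from source $i$ to sink $j$: $\mathcal{P}^{L_n}_{i,j}$ is the set of sequences of points $(k,y_k)$, $k=0,\dots,n$, with $y_k\in\{0,\dots,n\}$, $y_0=i$, $y_n=j$, $y_{k+1}\in\{y_k,y_k-1\}$ for $k<n$, and such that $y_{k+1}=y_k-1$ implies $y_k\ge n-k$. The weight $\omega(p)$ of a path is the product of the weights of its edges (steps), and the weight matrix is the $(n+1)\times(n+1)$ matrix whose $(i,j)$ entry is $\sum_{p\in\mathcal{P}^{L_n}_{i,j}}\omega(p)$. Here $L^{-1}$ is simply the name of the weight matrix defined in the claim. For $i>j$, $Q^{SD}_{i,j}$ is the set of strictly decreasing integer sequences $\alpha=(\alpha_1,\dots,\alpha_{i-j})$ of length $i-j$ with $0\le\alpha_r\le i-r$ for every $r$. Also $Q^{SD}_{i,i}=\{\varepsilon\}$ where $\varepsilon$ is the empty sequence, and $Q^{SD}_{i,j}=\emptyset$ for $i<j$. Empty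 products equal $1$ and empty sums equal $0$. *)

(* Defs.v *)
From HB Require Import structures.
From mathcomp Require Import all_boot all_order all_algebra reals.

Set Implicit Arguments.
Unset Strict Implicit.
Unset Printing Implicit Defensive.

Import Order.TTheory GRing.Theory Num.Theory.
Local Open Scope ring_scope.

(* A sequence of points (k, y_k), k = 0, ..., n, is encoded by the finite     *)
(* function k |-> y_k; widen_ord (leqnSn n) k and lift ord0 k are the indices *)
(* k and k+1 for k < n.                                                       *)
Definition points (n : nat) := {ffun 'I_n.+1 -> 'I_n.+1}.

Definition tail_of (n : nat) (y : points n) (k : 'I_n) : nat :=
  y (widen_ord (leqnSn n) k).

Definition head_of (n : nat) (y : points n) (k : 'I_n) : nat :=
  y (lift ord0 k).

(* Edges (k, a) -> (k+1, b) of the L-type network of order n: a fall is       *)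
(* b = a - 1 over the integers, hence written a = b.+1.                       *)
Definition Ledge (n k a b : nat) : bool :=
  (b == a) || ((a == b.+1) && (n - k <= a)%N).

Definition Lpaths (n : nat) (i j : 'I_n.+1) : {set points n} :=
  [set y : points n | [&& y ord0 == i, y ord_max == j &
     [forall k : 'I_n, Ledge n k (tail_of y k) (head_of y k)]]].

(* w k a b is the weight of the edge (k, a) -> (k+1, b).                      *)
Definition path_weight (R : realType) (n : nat) (w : nat -> nat -> nat -> R)
    (y : points n) : R :=
  \prod_(k < n) w k (tail_of y k) (head_of y k).

Definition Lweight_mx (R : realType) (n : nat) (w : nat -> nat -> nat -> R)
    : 'M[R]_n.+1 :=
  \matrix_(i, j) \sum_(p in Lpaths i j) path_weight w p.

(* t is total, but only its values t a b with a > b are ever read on an edge  *)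
(* of the network: a fall from (k, a) has n - k <= a and k < n.               *)
Definition Linv_edge (R : realType) (t : nat -> nat -> R) (n k a b : nat) : R :=
  if b == a then 1 else - t a (n - k - 1)%N.

(* The matrix called L^{-1}; the name carries no claim of invertibility.      *)
Definition Linv (R : realType) (t : nat -> nat -> R) (n : nat) : 'M[R]_n.+1 :=
  Lweight_mx n (Linv_edge t n).

(* alpha_r, with the 1-based index r.                                         *)
Definition entry (m b : nat) (alpha : m.-tuple 'I_b) (r : nat) : nat :=
  nth 0%N (map val alpha) r.-1.

(* Entries are taken in 'I_i, which loses nothing since alpha_r <= i - r < i. *)
(* As i - j is truncated, j <= i has to be required for Q to be empty when    *)
(* i < j; for i = j the only element is the empty tuple.                      *)
Definition QSD (i j : nat) : {set (i - j).-tuple 'I_i} :=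
  [set alpha : (i - j).-tuple 'I_i |
     [&& (j <= i)%N, sorted gtn (map val alpha) &
         [forall r : 'I_(i - j), (entry alpha r.+1 <= i - r.+1)%N]]].

(* Main.v *)
Require Import Defs.
From mathcomp Require Import all_boot all_order all_algebra reals.

Import Order.TTheory GRing.Theory Num.Theory.
Local Open Scope ring_scope.

(** A path from [i] to [j] is determined by the abscissas [k_1 < ... < k_(i-j)]
    of its falls.  Putting [alpha_r = n - k_r - 1] turns them into a strictly
    decreasing sequence; the [r]-th fall starts at height [i - r + 1], so the
    network condition [n - k_r <= i - r + 1] reads [alpha_r <= i - r] and the
    weight of that fall is [- t_(i-r+1, alpha_r)].  Both sides of the theorem
    are thus the same sum, up to the sign [(-1)^(i-j)].

    This bijection is carried out one column at a time rather than on whole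
    paths.  The path sum is an entry of the product of the one-step matrices
    of the [n] columns (path_sum_prod_mx).  Multiplying by the step matrix of
    column [n - m - 1] on the left either leaves the height alone or makes one
    fall, labelled [m]; correspondingly, a strictly decreasing sequence with
    entries at most [m] either avoids [m] or starts with it.  So the product of
    the last [m] step matrices is a sum over strictly decreasing sequences with
    entries below [m] (suffix_mx_prodE).  At [m = n] the sequences contributing
    to this sum are exactly the elements of [QSD i j] (perm_QSD). *)

(** * Path sums as matrix products *)

Definition ffun_cons (T : finType) (N : nat) (x : T) (g : {ffun 'I_N -> T}) :
    {ffun 'I_N.+1 -> T} :=
  [ffun k => oapp g x (unlift ord0 k)].

Lemma ffun_cons0 (T : finType) (N : nat) (x : T) (g : {ffun 'I_N -> T}) :
  ffun_cons T N x g ord0 = x.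
Proof. by rewrite ffunE unlift_none. Qed.

Lemma ffun_consS (T : finType) (N : nat) (x : T) (g : {ffun 'I_N -> T}) k :
  ffun_cons T N x g (lift ord0 k) = g k.
Proof. by rewrite ffunE liftK. Qed.

Lemma sum_ffun_cons (V : nmodType) (T : finType) (N : nat)
    (P : pred {ffun 'I_N.+1 -> T}) (F : {ffun 'I_N.+1 -> T} -> V) (x : T) :
  \sum_(y : {ffun 'I_N.+1 -> T} | (y ord0 == x) && P y) F y =
  \sum_(g : {ffun 'I_N -> T} | P (ffun_cons T N x g)) F (ffun_cons T N x g).
Proof.
rewrite (reindex_onto (ffun_cons T N x)
  (fun y => [ffun k => y (lift ord0 k)])) /=; last first.
  move=> y /andP[/eqP y0 _]; apply/ffunP => k; rewrite ffunE.
  by case: unliftP => [k' ->|->] //=; rewrite ffunE.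
apply: eq_bigl => g; rewrite ffun_cons0 eqxx /=.
suff -> : [ffun k => ffun_cons T N x g (lift ord0 k)] = g by rewrite eqxx andbT.
by apply/ffunP => k; rewrite ffunE ffun_consS.
Qed.

(** The transfer-matrix principle: expanding a product of matrices entrywise
    gives the sum over all sequences of intermediate indices.  The starting
    column [a] is free because peeling off the first step shifts it. *)
Lemma path_sum_prod_mx (R : pzRingType) (n : nat) (M : nat -> 'M[R]_n.+1)
    (N a : nat) (i j : 'I_n.+1) :
  \sum_(y : {ffun 'I_N.+1 -> 'I_n.+1} | (y ord0 == i) && (y ord_max == j))
     \prod_(k < N) M (a + k)%N (y (widen_ord (leqnSn N) k)) (y (lift ord0 k)) =
  (\prod_(a <= k < a + N) M k) i j.
Proof.
elim: N a i => [|N IH] a i.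
  rewrite addn0 big_geq // mxE sum_ffun_cons.
  have -> : ord_max = ord0 :> 'I_1 by apply: val_inj.
  under eq_bigl => g do rewrite ffun_cons0.
  under eq_bigr => g _ do rewrite big_ord0.
  rewrite sumr_const; case: eqP => [->|/eqP ij].
    rewrite (eq_card (B := predT)) => [|y]; last exact: eqxx.
    by rewrite card_ffun !card_ord expn0.
  by rewrite eq_card0 // => y; exact: negbTE ij.
rewrite sum_ffun_cons.
have -> : ord_max = lift ord0 (ord_max : 'I_N.+1) by apply: val_inj.
rewrite big_ltn ?addnS ?ltnS ?leq_addr // -addSn mxE.
rewrite (partition_big (fun g : {ffun 'I_N.+1 -> 'I_n.+1} => g ord0) predT) //=.
apply: eq_bigr => l _; rewrite -IH big_distrr /=.
apply: eq_big => [g|g /andP[_ /eqP g0]]; first by rewrite ffun_consS andbC.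
rewrite big_ord_recl addn0 ffun_consS g0.
rewrite (_ : widen_ord _ _ = ord0) ?ffun_cons0; last exact: val_inj.
congr (_ * _); apply: eq_bigr => k _.
rewrite ffun_consS addSnnS; congr (M _ _ _).
by rewrite (_ : widen_ord _ _ = lift ord0 (widen_ord (leqnSn N) k))
  ?ffun_consS //; apply: val_inj.
Qed.

Definition step_mx (R : realType) (t : nat -> nat -> R) (n k : nat) :
    'M[R]_n.+1 :=
  \matrix_(a, b) (if Ledge n k a b then Linv_edge t n k a b else 0).

Lemma Linv_prod_step_mx (R : realType) (t : nat -> nat -> R) (n : nat)
    (i j : 'I_n.+1) :
  Linv t n i j = (\prod_(0 <= k < n) step_mx R t n k) i j.
Proof.
rewrite -(path_sum_prod_mx _ _ _ n 0) mxE big_mkcond [RHS]big_mkcond /=.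
apply: eq_bigr => y _; rewrite inE andbA; case: ifP => [|/=]; last first.
  case: ifP => //= _ /forallPn[k nk].
  by rewrite (bigD1 k) //= mxE (negbTE nk) mul0r.
case/andP=> -> /forallP yP; apply: eq_bigr => k _.
by rewrite mxE yP.
Qed.

(** * Strictly decreasing sequences of fall labels *)

(** Enumerated as a list, not as a set of tuples, so that sequences of all
    lengths are present and the choice of the first entry is a concatenation
    through which sums split by [big_cat] and [big_map]. *)
Fixpoint decr_seqs (m : nat) : seq (seq nat) :=
  if m is m'.+1 then map (cons m') (decr_seqs m') ++ decr_seqs m'
  else [:: [::]].

Lemma mem_decr_seqs (m : nat) (s : seq nat) :
  (s \in decr_seqs m) = sorted gtn s && all (gtn m) s.
Proof.
have gtn_trans : transitive gtn by move=> y x z /= xy yz; apply: ltn_trans xy.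
elim: m s => [|m IH] [|a s] //=; first by rewrite inE andbF.
  by rewrite mem_cat IH orbT.
rewrite mem_cat IH /= path_sortedE // ltnS.
have -> : (a :: s \in map (cons m) (decr_seqs m)) =
          (a == m) && (s \in decr_seqs m).
  apply/mapP/andP => [[s' s'P [-> ->]]|[/eqP -> sP]]; first by rewrite eqxx.
  by exists s.
have weaken : all (gtn m) s -> all (gtn m.+1) s.
  by apply: sub_all => x /= /ltnW.
rewrite IH; case: (ltngtP a m) => [am|_|->]; rewrite /= ?andbF //.
- have sub : all (gtn a) s -> all (gtn m) s.
    by apply: sub_all => x /= xa; apply: ltn_trans am.
  by case sa: (all (gtn a) s) => //=; rewrite weaken sub.
- by case sm: (all (gtn m) s); rewrite ?andbF //= weaken // andbT orbF.
Qed.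

Lemma decr_seqs_uniq (m : nat) : uniq (decr_seqs m).
Proof.
elim: m => // m IH /=; rewrite cat_uniq IH map_inj_uniq ?IH; last by move=> ? ? [].
rewrite andbT /=; apply/hasPn => s sm; apply/mapP => -[s' _ es].
by move: sm; rewrite es mem_decr_seqs /= ltnn andbF.
Qed.

(** The network condition, read on the labels of successive falls of a path
    that starts at height [h]: a fall from [(k, h)] has label [n - k - 1], so
    that [n - k <= h] says exactly that its label is below [h]. *)
Fixpoint admissible (h : nat) (s : seq nat) : bool :=
  if s is a :: s' then (a < h)%N && admissible h.-1 s' else true.

Fixpoint falls_weight (R : pzRingType) (t : nat -> nat -> R) (h : nat)
    (s : seq nat) : R :=
  if s is a :: s' then - t h a * falls_weight R t h.-1 s' else 1.

Lemma admissibleP (h : nat) (s : seq nat) :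
  reflect (forall r, (r < size s)%N -> (nth 0%N s r < h - r)%N)
          (admissible h s).
Proof.
elim: s h => [|a s IH] h /=; first by constructor.
apply: (iffP andP) => [[ah /IH sh] [|r] /=|H].
- by rewrite subn0.
- by rewrite ltnS => /sh; rewrite -subn1 -subnDA.
split; first by have := H 0%N isT; rewrite subn0.
by apply/IH => r rs; have := H r.+1 rs; rewrite -subn1 -subnDA.
Qed.

Lemma admissible_lt (h : nat) (s : seq nat) :
  admissible h s -> all (gtn h) s.
Proof.
move/admissibleP => sh; apply/(all_nthP 0%N) => r /sh /= /leq_trans; apply.
exact: leq_subr.
Qed.

(** Listed in order of increasing start height [q.+1], the falls appear in
    reverse order, whence the index [(h - q).-1]. *)
Lemma falls_weightE (R : comPzRingType) (t : nat -> nat -> R) (l h : nat)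
    (s : seq nat) :
  (l + size s)%N = h ->
  falls_weight R t h s =
  (-1) ^+ size s * \prod_(l <= q < h) t q.+1 (nth 0%N s (h - q).-1).
Proof.
elim: s h => [|a s IH] h /= <-; first by rewrite addn0 big_geq // mulr1.
rewrite addnS /= (IH (l + size s)%N) // big_nat_recr ?leq_addr //=.
rewrite subSnn /= [in RHS]exprS.
rewrite [in RHS](eq_big_nat _ _ (F2 := fun q =>
  t q.+1 (nth 0%N s (l + size s - q).-1))) => [|q /andP[_ qh]].
  by rewrite mulrC mulrN !mulNr mul1r !mulrA.
by rewrite subSn ?(ltnW qh) //= -[in LHS](prednK (_ : 0 < l + size s - q)%N)
  ?subn_gt0.
Qed.

(** * Column-by-column expansion *)

(** Row [i] of the step matrix of column [n - m - 1] has at most two nonzero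
    entries: the horizontal edge, and the fall labelled [m]. *)
Lemma step_mx_mulE (R : realType) (t : nat -> nat -> R) (n m : nat)
    (X : 'M[R]_n.+1) (i j : 'I_n.+1) : (m < n)%N ->
  (step_mx R t n (n - m.+1) *m X) i j =
  X i j + (if (m < i)%N then - t i m * X (inord i.-1) j else 0).
Proof.
move=> mn; rewrite mxE (bigD1 i) //= mxE /Ledge /Linv_edge eqxx mul1r.
congr (_ + _).
have e1 : (n - (n - m.+1))%N = m.+1 by rewrite subKn.
case: ifP => mi; last first.
  apply: big1 => l li; rewrite mxE /Ledge e1 mi andbF orbF.
  by rewrite (negbTE (_ : nat_of_ord l != i)) ?mul0r.
have i0 : (0 < i)%N by apply: leq_ltn_trans mi.
have vi : nat_of_ord (inord i.-1 : 'I_n.+1) = i.-1.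
  by rewrite inordK // (leq_ltn_trans (leq_pred _)).
rewrite (bigD1 (inord i.-1)) /=; last first.
  by rewrite -val_eqE /= vi -{2}(prednK i0) neq_ltn ltnSn.
rewrite mxE /Ledge /Linv_edge vi prednK // e1 eqxx mi orbT subn1 /=.
rewrite ifF; last by rewrite -{2}(prednK i0) ltn_eqF.
rewrite big1 ?addr0 // => l /andP[li li'].
rewrite mxE /Ledge (negbTE (_ : nat_of_ord l != i)) //=.
rewrite ifF ?mul0r //; apply/negbTE; rewrite negb_and; apply/orP; left.
apply: contra li' => /eqP il; apply/eqP/val_inj => /=.
by rewrite vi il.
Qed.

(** The sum splits according to whether the first label is [m], which matches
    the two entries in the row of the new step matrix. *)
Lemma suffix_mx_prodE (R : realType) (t : nat -> nat -> R) (n m : nat)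
    (i j : 'I_n.+1) : (m <= n)%N ->
  (\prod_(n - m <= k < n) step_mx R t n k) i j =
  \sum_(s <- decr_seqs m | (j + size s == i)%N && admissible i s)
     falls_weight R t i s.
Proof.
elim: m i => [|m IH] i mn.
  rewrite subn0 big_geq // mxE big_cons big_nil addn0 andbT /= addr0.
  by rewrite eq_sym -val_eqE; case: eqP.
rewrite big_ltn; last by rewrite ltn_subrL (leq_trans _ mn).
rewrite subnSK // step_mx_mulE // !IH ?(ltnW mn) //.
rewrite /= big_cat big_map /= addrC; congr (_ + _).
case: ifP => mi; last by rewrite big_pred0 // => s; rewrite andbF.
have i0 : (0 < i)%N by apply: leq_ltn_trans mi.
rewrite inordK; last by rewrite (leq_ltn_trans (leq_pred _)).
rewrite big_distrr /=; apply: eq_bigl => s.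
by rewrite addnS -[in LHS]eqSS prednK.
Qed.

(** * Identification with [QSD] *)

(** The two sides bound the entries differently, by [i] and by [n], but
    admissibility already forces every entry below [i <= n]
    (admissible_lt). *)
Lemma perm_QSD (n i j : nat) : (i <= n)%N ->
  perm_eq [seq map val (alpha : (i - j).-tuple 'I_i) | alpha in QSD i j]
          [seq s <- decr_seqs n | (j + size s == i)%N && admissible i s].
Proof.
move=> i_n; apply: uniq_perm.
- rewrite map_inj_uniq ?enum_uniq // => x y /(inj_map val_inj) /val_inj //.
- exact/filter_uniq/decr_seqs_uniq.
move=> s; rewrite mem_filter mem_decr_seqs.
apply/mapP/andP => [[alpha]|].
  rewrite mem_enum inE => /and3P[ji sa /forallP Ha] ->.
  have ad : admissible i (map val alpha).
    apply/admissibleP => r; rewrite size_map size_tuple => rs.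
    have := Ha (Ordinal rs); rewrite /entry /= => /leq_ltn_trans; apply.
    by rewrite subnS prednK // subn_gt0 (leq_trans rs) // leq_subr.
  rewrite size_map size_tuple subnKC // eqxx sa; split => //.
  by apply: sub_all (admissible_lt _ _ ad) => x /= /leq_trans; apply.
case=> /andP[/eqP ss ad] /andP[sa _].
have sz : size s = (i - j)%N by rewrite -ss addKn.
have ai := admissible_lt _ _ ad.
(* The preimage of [s]: [insub] drops nothing, since all entries are below [i]. *)
have es : map val (pmap (insub : nat -> option 'I_i) s) = s.
  by rewrite pmap_filter ?(all_filterP _) //;
    [apply: sub_all ai => x xi; rewrite insubT | move=> x; apply: insubK].
have szp : size (pmap (insub : nat -> option 'I_i) s) == (i - j)%N.
  by rewrite -(size_map val) es sz.
exists (Tuple szp) => //; rewrite mem_enum inE /= es sa -{1}ss leq_addr /=.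
apply/forallP => r; rewrite /entry /= es.
have rs : (r < size s)%N by rewrite sz.
have := admissibleP _ _ ad r rs.
by move=> lt_r; rewrite subnS -ltnS (ltn_predK lt_r).
Qed.

Theorem theorem4p2 (R : realType) (n : nat) (hn : (1 <= n)%N)
    (t : nat -> nat -> R) (i j : 'I_n.+1) :
  Linv t n i j =
  (-1) ^ (i%:Z - j%:Z) *
  \sum_(alpha in QSD i j) \prod_(j <= s < i) t s.+1 (entry alpha (i - s)).
Proof.
have := suffix_mx_prodE R t n n i j (leqnn n).
rewrite subnn -Linv_prod_step_mx => ->.
rewrite -big_filter -(perm_big _ (perm_QSD n i j (leq_ord i))) /=.
rewrite big_image /= big_distrr /=; apply: eq_bigr => alpha.
rewrite inE => /and3P[ji _ _].
have sz : size (map val alpha) = (i - j)%N by rewrite size_map size_tuple.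
rewrite (falls_weightE _ _ j) sz ?subnKC //.
by rewrite subzn.
Qed.
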